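(* Let $n\in\mathbb{N}$ and let $\mathbf{A}\in\mathbb{R}^{n\times n}$ have $n$ distinct eigenvalues $\lambda_1,\ldots,\lambda_n$, with right eigenvectors $\mathbf{v}_j\in\mathbb{C}^n$ ($\mathbf{A}\mathbf{v}_j=\lambda_j\mathbf{v}_j$) and left eigenvectors $\mathbf{u}_j\in\mathbb{C}^n$ ($\mathbf{u}_j^\top\mathbf{A}=\lambda_j\mathbf{u}_j^\top$) normalized so that $\mathbf{u}_j^\top\mathbf{v}_k=1$ if $j=k$ and $\mathbf{u}_j^\top\mathbf{v}_k=0$ if $j\neq k$. Consider the linear time-invariant system $\dot{\mathbf{x}}=\mathbf{A}\mathbf{x}$ on $\mathbb{R}^n$, with solution $\bar{\mathbf{x}}(t;\mathbf{x}^0)$ starting from $\mathbf{x}^0$ at $t=0$, the modal variables $z_j=\mathbf{u}_j^\top\mathbf{x}$ with time evolution $\bar z_j(t;\mathbf{x}^0)=\mathbf{u}_j^\top\bar{\mathbf{x}}(t;\mathbf{x}^0)$, the participation factors $P_j^k:=u_{jk}v_{jk}$, and the mode-in-state generalized participations $P_j^{k(\ell)}:=u_{j\ell}v_{jk}$. For $\mathbf{x}^0\in\mathbb{R}^n$ and a given initial change $\delta\mathbf{x}=(\delta x_1,\ldots,\delta x_n)^\top\in\mathbb{R}^n$, define the variations $$\mathrm{d}x_k(t;\delta\mathbf{x}):=\bar x_k(t;\mathbf{x}^0+\delta\mathbf{x})-\bar x_k(t;\mathbf{x}^0),\qquad \mathrm{d}z_j(t;\delta\mathbf{x}):=\bar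 z_j(t;\mathbf{x}^0+\delta\mathbf{x})-\bar z_j(t;\mathbf{x}^0).$$ Then for all $k,j\in\{1,\ldots,n\}$ and all $t$, $$\mathrm{d}x_k(t;\delta\mathbf{x})=\sum_{j=1}^n e^{\lambda_j t}P_j^k\,\delta x_k+\sum_{j=1}^n\sum_{\substack{\ell=1\\ \ell\neq k}}^n e^{\lambda_j t}P_j^{k(\ell)}\,\delta x_\ell,$$ $$\mathrm{d}z_j(t;\delta\mathbf{x})=e^{\lambda_j t}\left(\sum_{k=1}^n P_j^k\right)\delta z_j^0,$$ where $\delta z_j^0:=\mathrm{d}z_j(0;\delta\mathbf{x})=\mathbf{u}_j^\top\delta\mathbf{x}$ is the initial change to the $j$-th mode.
   Context: For a vector $\mathbf{x}$ or an indexed vector $\mathbf{v}_j$, the $k$-th elements are written $x_k$ and $v_{jk}$; the transpose $\top$ involves no complex conjugation. *)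

(* Defs.v *)
From HB Require Import structures.
From mathcomp Require Import all_boot all_order all_algebra.
From mathcomp Require Import all_classical all_reals all_analysis.
From mathcomp Require Import complex.
Set Implicit Arguments.
Unset Strict Implicit.
Unset Printing Implicit Defensive.
Import Order.TTheory GRing.Theory Num.Theory.
Import numFieldNormedType.Exports.
Local Open Scope ring_scope.
Local Open Scope complex_scope.

Definition cexp (R : realType) (z : R[i]) : R[i] :=
  (expR (complex.Re z) * cos (complex.Im z))
    +i* (expR (complex.Re z) * sin (complex.Im z)).

Notation toCmx R M := (map_mx (real_complex R) M).

(* u^T w, a bilinear pairing: no complex conjugation is involved. *)
Definition tdot (R : realType) (n : nat) (u w : 'cV[R[i]]_n) : R[i] :=
  (u^T *m w) 0 0.

Definition right_eigenvector (R : realType) (n : nat) (A : 'M[R]_n)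
    (a : R[i]) (v : 'cV[R[i]]_n) : Prop :=
  v <> 0 /\ toCmx R A *m v = a *: v.

Definition left_eigenvector (R : realType) (n : nat) (A : 'M[R]_n)
    (a : R[i]) (u : 'cV[R[i]]_n) : Prop :=
  u <> 0 /\ u^T *m toCmx R A = a *: u^T.

(* [xbar t x0] is the value at time t of the solution of x' = A x that starts
   from x0 at time 0. *)
Definition is_lti_solution (R : realType) (n : nat) (A : 'M[R]_n)
    (xbar : R -> 'cV[R]_n -> 'cV[R]_n) : Prop :=
  forall x0 : 'cV[R]_n,
    xbar 0 x0 = x0 /\
    forall t : R,
      is_derive t 1 (fun s : R => xbar s x0) (A *m xbar t x0).

Definition zbar (R : realType) (n : nat) (u : 'I_n -> 'cV[R[i]]_n)
    (xbar : R -> 'cV[R]_n -> 'cV[R]_n) (j : 'I_n) (t : R)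
    (x0 : 'cV[R]_n) : R[i] :=
  tdot (u j) (toCmx R (xbar t x0)).

Definition participation (R : realType) (n : nat) (u v : 'I_n -> 'cV[R[i]]_n)
    (j k : 'I_n) : R[i] :=
  u j k 0 * v j k 0.

(* Mode-in-state generalized participation P_j^{k(l)}. *)
Definition gen_participation (R : realType) (n : nat) (u v : 'I_n -> 'cV[R[i]]_n)
    (j k l : 'I_n) : R[i] :=
  u j l 0 * v j k 0.

Definition dx (R : realType) (n : nat)
    (xbar : R -> 'cV[R]_n -> 'cV[R]_n) (x0 : 'cV[R]_n)
    (k : 'I_n) (t : R) (deltax : 'cV[R]_n) : R :=
  xbar t (x0 + deltax) k 0 - xbar t x0 k 0.

Definition dz (R : realType) (n : nat) (u : 'I_n -> 'cV[R[i]]_n)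
    (xbar : R -> 'cV[R]_n -> 'cV[R]_n) (x0 : 'cV[R]_n)
    (j : 'I_n) (t : R) (deltax : 'cV[R]_n) : R[i] :=
  zbar u xbar j t (x0 + deltax) - zbar u xbar j t x0.

(* Main.v *)
(* Pairing with the left eigenvector [u j] decouples the system into the scalar
   equations z_j' = lam_j z_j, hence z_j(t) = exp(lam_j t) z_j(0); the state is
   recovered from the modes as x = sum_j z_j v_j, because the families u and v
   are dual bases. *)

Require Import Defs.
From HB Require Import structures.
From mathcomp Require Import all_boot all_order all_algebra.
From mathcomp Require Import all_classical all_reals all_analysis.
From mathcomp Require Import complex.
From mathcomp Require Import ring.
Set Implicit Arguments.
Unset Strict Implicit.
Unset Printing Implicit Defensive.
Import Order.TTheory GRing.Theory Num.Theory.
Import numFieldNormedType.Exports.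
Local Open Scope ring_scope.
Local Open Scope complex_scope.

(** Derivatives of vector functions are taken entrywise, and pairing with the constant [c] is a
    finite linear combination of the entries. *)
Lemma is_derive_dot (R : realType) (n : nat) (c : 'cV[R]_n)
    (x : R -> 'cV[R]_n) (t : R) (d : 'cV[R]_n) :
  is_derive t 1 x d ->
  is_derive t 1 (fun s => (c^T *m x s) 0 0) ((c^T *m d) 0 0).
Proof.
move=> [xt dxt].
have xit i : is_derive t 1 (fun s => x s i 0) (d i 0).
  split; first by move/derivable_mxP: xt; apply.
  by rewrite -dxt derive_mx // mxE.
have -> : (fun s => (c^T *m x s) 0 0) = \sum_(i < n) c i 0 \*: (fun s => x s i 0).
  by apply/funext => s; rewrite mxE fct_sumE; apply: eq_bigr => i _; rewrite mxE.
have -> : (c^T *m d) 0 0 = \sum_(i < n) c i 0 *: d i 0.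
  by rewrite mxE; apply: eq_bigr => i _; rewrite mxE.
exact: is_derive_sum.
Qed.

Lemma is_derive_comp_scale (R : realType) (f : R -> R) (a x df : R) :
  is_derive (a * x) 1 f df -> is_derive x 1 (fun s : R => f (a * s)) (a * df).
Proof.
move=> dfx; have dax : is_derive x 1 (a \*: @id R) (a *: (1 : R)).
  exact: is_deriveZ.
rewrite mulrC -[a in X in is_derive _ _ _ X]mulr1.
exact: is_derive1_comp dfx dax.
Qed.

(* The quantities [f] and [g] below are the real and imaginary parts of
   [cexp (- lam * t) * (p t +i* q t)], which is constant along solutions. *)
Lemma complex_linear_ode (R : realType) (a b : R) (p q : R -> R) :
  (forall t : R, is_derive t 1 p (a * p t - b * q t)) ->
  (forall t : R, is_derive t 1 q (b * p t + a * q t)) ->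
  forall t : R, p t +i* q t = cexp ((a +i* b) * t%:C) * (p 0 +i* q 0).
Proof.
move=> dp dq t.
pose e (s : R) := expR (- a * s).
pose c (s : R) := cos (b * s); pose d (s : R) := sin (b * s).
have de (s : R) : is_derive s 1 e (- a * e s) by exact: is_derive_comp_scale.
have dc (s : R) : is_derive s 1 c (b * - d s) by exact: is_derive_comp_scale.
have dd (s : R) : is_derive s 1 d (b * c s) by exact: is_derive_comp_scale.
have e0 : e 0 = 1 by rewrite /e mulr0 expR0.
have c0 : c 0 = 1 by rewrite /c mulr0 cos0.
have d0 : d 0 = 0 by rewrite /d mulr0 sin0.
have Ee : expR (a * t) * e t = 1 by rewrite /e mulNr expRN divff // gt_eqF ?expR_gt0.
have cd : c t ^+ 2 + d t ^+ 2 = 1 by exact: cos2Dsin2.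
have -> : cexp ((a +i* b) * t%:C) =
    (expR (a * t) * c t) +i* (expR (a * t) * d t).
  by rewrite /cexp /= !mulr0 add0r subr0.
(* From here [e], [c], [d] are known only through their derivatives, their values at 0 and the
   identities [Ee] and [cd]; [ring] treats them as atoms. *)
move: (expR (a * t)) Ee => E Ee; clearbody e c d.
pose f := e * (c * p + d * q); pose g := e * (c * q - d * p).
have ft : f t = f 0.
  (* The product rule yields the derivative of [f] by instance inference; [ring] checks that it
     vanishes. *)
  apply: is_derive_0_is_cst => s; apply: is_derive_eq.
  by rewrite /GRing.scale /= !fctE; ring.
have gt : g t = g 0.
  apply: is_derive_0_is_cst => s; apply: is_derive_eq.
  by rewrite /GRing.scale /= !fctE; ring.
have f0 : f 0 = p 0 by rewrite /f !fctE e0 c0 d0; ring.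
have g0 : g 0 = q 0 by rewrite /g !fctE e0 c0 d0; ring.
rewrite -f0 -g0 -ft -gt /f /g !fctE.
apply/eqP; rewrite eq_complex /=; apply/andP; split; apply/eqP.
(* The factors [E * e t] and [c t ^+ 2 + d t ^+ 2], both equal to 1, are inserted on the left to
   match the expanded product. *)
all: by rewrite -[LHS]mul1r -Ee -[LHS]mulr1 -cd; ring.
Qed.

(** Since [x] is real, the pairing splits into two real ones, so a complex mode can be
    differentiated through real functions only. *)
Lemma tdot_real (R : realType) (n : nat) (u : 'cV[R[i]]_n) (x : 'cV[R]_n) :
  tdot u (toCmx R x) =
    ((map_mx (@complex.Re R) u)^T *m x) 0 0
      +i* ((map_mx (@complex.Im R) u)^T *m x) 0 0.
Proof.
rewrite /tdot !mxE.
elim/big_ind3: _ => // [_ _ x1 _ _ x2 -> ->|i _] //.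
rewrite !mxE; case: (u i 0) => a b /=.
by apply/eqP; rewrite eq_complex /= !mulr0 subr0 add0r eqxx mulrC eqxx.
Qed.

Lemma tdotB (R : realType) (n : nat) (u x y : 'cV[R[i]]_n) :
  tdot u (x - y) = tdot u x - tdot u y.
Proof. by rewrite /tdot mulmxBr !mxE. Qed.

Lemma zbar_cexp (R : realType) (n : nat) (A : 'M[R]_n)
    (lam : 'I_n -> R[i]) (u : 'I_n -> 'cV[R[i]]_n)
    (xbar : R -> 'cV[R]_n -> 'cV[R]_n) (j : 'I_n) (t : R) (x0 : 'cV[R]_n) :
  left_eigenvector A (lam j) (u j) -> is_lti_solution A xbar ->
  zbar u xbar j t x0 = cexp (lam j * t%:C) * tdot (u j) (toCmx R x0).
Proof.
move=> [_ uA] /(_ x0)[x00 dx0].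
pose p s := ((map_mx (@complex.Re R) (u j))^T *m xbar s x0) 0 0.
pose q s := ((map_mx (@complex.Im R) (u j))^T *m xbar s x0) 0 0.
have zpq s : zbar u xbar j s x0 = p s +i* q s by exact: tdot_real.
(* The left eigenvector equation moves [A] off the state; the real and imaginary parts of this
   identity are the planar system for [p] and [q]. *)
have dz s : tdot (u j) (toCmx R (A *m xbar s x0)) = lam j * (p s +i* q s).
  by rewrite -zpq /zbar /tdot map_mxM mulmxA uA -scalemxAl mxE.
rewrite -[in tdot _ _]x00 -/(zbar u xbar j 0 x0) !zpq.
move: dz; case: (lam j) => a b dz.
apply: (@complex_linear_ode _ _ _ p q) => s.
  apply: is_derive_eq (is_derive_dot _ (dx0 s)) _.
  by have := dz s; rewrite tdot_real => -[].
apply: is_derive_eq (is_derive_dot _ (dx0 s)) _.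
by have := dz s; rewrite tdot_real => -[_ ->]; rewrite addrC.
Qed.

(* A left inverse of a square matrix is a right inverse, so biorthogonality
   also gives the completeness relation. *)
Lemma biorthogonal_expansion (R : realType) (n : nat)
    (u v : 'I_n -> 'cV[R[i]]_n) (x : 'cV[R[i]]_n) :
  (forall j k, tdot (u j) (v k) = if j == k then 1 else 0) ->
  forall k, x k 0 = \sum_(j < n) v j k 0 * tdot (u j) x.
Proof.
move=> uv k.
(* The vectors [u j] are the rows of [U] and the [v j] the columns of [V], so biorthogonality reads
   [U *m V = 1]. *)
pose U := \matrix_(j < n, l < n) u j l 0.
pose V := \matrix_(l < n, j < n) v j l 0.
have UV : U *m V = 1%:M.
  apply/matrixP => i j; rewrite !mxE.
  transitivity (tdot (u i) (v j)); last by rewrite uv; case: eqP.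
  by rewrite /tdot mxE; apply: eq_bigr => l _; rewrite !mxE.
rewrite -[x in LHS]mul1mx -(mulmx1C UV) -mulmxA mxE; apply: eq_bigr => j _.
rewrite !mxE; congr (_ * _); rewrite /tdot mxE.
by apply: eq_bigr => l _; rewrite !mxE.
Qed.

Theorem proposition1 (R : realType) (n : nat) (A : 'M[R]_n)
    (lam : 'I_n -> R[i]) (v u : 'I_n -> 'cV[R[i]]_n)
    (lam_distinct : injective lam)
    (v_right : forall j : 'I_n, right_eigenvector A (lam j) (v j))
    (u_left : forall j : 'I_n, left_eigenvector A (lam j) (u j))
    (uv_normalized : forall j k : 'I_n,
       tdot (u j) (v k) = if j == k then 1 else 0)
    (xbar : R -> 'cV[R]_n -> 'cV[R]_n)
    (xbar_sol : is_lti_solution A xbar)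
    (x0 deltax : 'cV[R]_n) :
  (forall (k : 'I_n) (t : R),
     (dx xbar x0 k t deltax)%:C =
       \sum_(j < n) cexp (lam j * t%:C) * participation u v j k * (deltax k 0)%:C
       + \sum_(j < n) \sum_(l < n | l != k)
           cexp (lam j * t%:C) * gen_participation u v j k l * (deltax l 0)%:C) /\
  (forall (j : 'I_n) (t : R),
     dz u xbar x0 j t deltax =
       cexp (lam j * t%:C) * (\sum_(k < n) participation u v j k)
       * dz u xbar x0 j 0 deltax) /\
  (forall j : 'I_n,
     dz u xbar x0 j 0 deltax = tdot (u j) (toCmx R deltax)).
Proof.
(* Both trajectories carry the same exponential factor, so by linearity only the initial difference
   [deltax] remains. *)
have dzE j t : dz u xbar x0 j t deltax =
    cexp (lam j * t%:C) * tdot (u j) (toCmx R deltax).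
  rewrite /dz !(zbar_cexp _ _ (u_left j) xbar_sol) -mulrBr -tdotB -map_mxB.
  by rewrite addrC addKr.
have dz0 j : dz u xbar x0 j 0 deltax = tdot (u j) (toCmx R deltax).
  by rewrite /dz /zbar !(xbar_sol _).1 -tdotB -map_mxB addrC addKr.
split=> [k t|]; last split=> [j t|//].
- transitivity (toCmx R (xbar t (x0 + deltax) - xbar t x0) k 0).
    by rewrite !mxE.
  rewrite (biorthogonal_expansion _ uv_normalized) -big_split /=.
  apply: eq_bigr => j _.
  have -> : tdot (u j) (toCmx R (xbar t (x0 + deltax) - xbar t x0)) =
            dz u xbar x0 j t deltax.
    by rewrite map_mxB tdotB.
  (* Splitting off [l = k] in the pairing with [deltax] separates the participation factors from the
     generalized ones. *)
  rewrite dzE /tdot mxE (bigD1 k) //= !mxE !mulrDr; congr (_ + _).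
    by rewrite /participation; ring.
  rewrite !mulr_sumr; apply: eq_bigr => l _.
  by rewrite !mxE /gen_participation; ring.
(* This sum is the pairing of [u j] with [v j], equal to 1 by normalization. *)
- have -> : \sum_(k < n) participation u v j k = 1.
    have := uv_normalized j j; rewrite eqxx => <-.
    by rewrite /tdot mxE; apply: eq_bigr => k _; rewrite mxE.
  by rewrite mulr1 dz0 dzE.
Qed.
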